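(* Let $F:D(F)\subseteq\mathcal X\to\mathcal Y$, $f^\dagger$, $g=F(f^\dagger)$, the Hilbert scale $\{\mathcal X_\nu\}_{\nu\in\mathbb R}$ and the indices $a,s,u$ satisfy the Basic Assumption, and let the Conditional Stability Assumption hold with concave index function $\varphi$, constant $R>0$ and admissible set $Q$ (both assumptions are spelled out in the context). For $\delta>0$ let $g^\delta\in\mathcal Y$ satisfy $\|g^\delta-g\|_{\mathcal Y}\le\delta$, and for $\alpha>0$ let $$f_\alpha^\delta\in\operatorname*{argmin}_{f\in D(F)}\left[\tfrac12\|F(f)-g^\delta\|_{\mathcal Y}^2+\alpha\|f\|_s^2\right].$$ Let the regularization parameter $\alpha>0$ be chosen a priori ($\alpha=\alpha(\delta)$) or a posteriori ($\alpha=\alpha(\delta,g^\delta)$) such that for all sufficiently small noise levels $0<\delta\le\bar\delta$ the regularized solutions $f_\alpha^\delta$ belong to $Q$. Put $$\psi_{u,s,a}(t):=\left(\varphi(\sqrt t)\right)^{\frac{2(u-s)}{a+u}},\qquad t\ge 0 .$$ Then there is a constant $C=C(R,\|f^\dagger\|_u,u,s,a)>0$ such that for all such $\delta$ $$\|f_\alpha^\delta-f^\dagger\|_s^2\le\frac{\delta^2}{\alpha}+C\,(-\psi_{u,s,a})^*\left(-\frac{1}{8C\alpha}\right),$$ where $(-\psi_{u,s,a})^*(-v)=\sup_{t\ge0}\left[\psi_{u,s,a}(t)-vt\right]$ for $v>0$.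
   Context: $\mathcal X$ (norm $\|\cdot\|$) and $\mathcal Y$ (norm $\|\cdot\|_{\mathcal Y}$) are infinite-dimensional separable real Hilbert spaces, $F:D(F)\subseteq\mathcal X\to\mathcal Y$ is a possibly nonlinear operator, and $f^\dagger\in D(F)$ is the unique solution of $F(f)=g$ for the exact right-hand side $g=F(f^\dagger)$ (also written $g^\dagger$). The equation is assumed locally ill-posed at $f^\dagger$: for every $r>0$ there is a sequence $(f_n)\subset D(F)$ with $\|f_n-f^\dagger\|\le r$, $\liminf_n\|f_n-f^\dagger\|>0$ and $\|F(f_n)-F(f^\dagger)\|_{\mathcal Y}\to0$. Hilbert scale: $L:D(L)\subset\mathcal X\to\mathcal X$ is a densely defined, closed, unbounded, self-adjoint linear operator that is strictly positive, with $\|Lx\|\ge m\|x\|$ for all $x\in D(L)$ and some $m>0$. It generates the Hilbert scale $\mathcal X_\nu=D(L^\nu)$, $\nu\in\mathbb R$, $\mathcal X_0=\mathcal X$, with norms $\|x\|_\nu=\|L^\nu x\|$ (for $\nu<0$, completion of $\mathcal X$ in this norm). In the Tikhonov functional $\|f\|_s=\infty$ if $f\notin\mathcal X_s$. Balls: $D_\mu^\nu(\bar f)=\{f\in\mathcal X_\nu:\|f-\bar f\|_\nu\le\mu\}\cap D(F)$. Index function: a continuous, strictly increasing function $\varphi:[0,\infty)\to[0,\infty)$ with $\varphi(0)=0$. Basic Assumption: (a) $D(F)$ is a convex and closed subset of $\mathcal X$. (b) $F$ is weak-to-weak sequentially continuous: $x_n\rightharpoonup\bar x$ in $\mathcal X$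 with $x_n\in D(F)$ and $\bar x\in D(F)$ implies $F(x_n)\rightharpoonup F(\bar x)$ in $\mathcal Y$. (c) There is $u>0$ with $f^\dagger\in\mathcal X_u$, where $f^\dagger\in D(F)$ is the unique solution of $F(f)=g$. (d) There are indices $a,s\in\mathbb R$ with $a\ge0$, $0\le s<u\le2s+a$ and $-a<s$. Conditional Stability Assumption: there are a concave index function $\varphi$, values $\theta\ge0$, $\rho>0$, $R>0$ and a subset $Q\subseteq D_\rho^\theta(f^\dagger)$ such that $\|f-f^\dagger\|_{-a}\le R\,\varphi(\|F(f)-F(f^\dagger)\|_{\mathcal Y})$ for all $f\in Q$. Fenchel conjugate: $h^*(y)=\sup_x[xy-h(x)]$, where functions defined on $[0,\infty)$ (here $-\psi_{u,s,a}$) are extended by $+\infty$ to negative arguments. *)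

(* Defs.v *)
From HB Require Import structures.
From mathcomp Require Import all_boot all_order all_algebra.
From mathcomp Require Import all_classical all_reals all_analysis.

Set Implicit Arguments.
Unset Strict Implicit.
Unset Printing Implicit Defensive.

Import Order.TTheory GRing.Theory Num.Theory.
Import numFieldNormedType.Exports.

Local Open Scope classical_set_scope.
Local Open Scope ring_scope.

HB.mixin Record isHilbert (R : realType) V & CompleteNormedModule R V := {
  dotp : V -> V -> R ;
  dotpC : forall x y, dotp x y = dotp y x ;
  dotpDl : forall x y z, dotp (x + y) z = dotp x z + dotp y z ;
  dotpZl : forall (c : R) x y, dotp (c *: x) y = c * dotp x y ;
  dotpp : forall x, dotp x x = `|x| ^+ 2
}.

#[short(type="hilbertType")]
HB.structure Definition Hilbert (R : realType) :=
  {V of isHilbert R V & CompleteNormedModule R V}.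

Definition separable (T : topologicalType) :=
  exists2 A : set T, countable A & dense A.

Definition infinite_dimensional (R : realType) (V : lmodType R) :=
  forall (n : nat) (b : 'I_n -> V),
    exists x : V, forall c : 'I_n -> R, x <> \sum_(i < n) c i *: b i.

Definition weak_cvg (R : realType) (V : hilbertType R) (x_ : nat -> V) (x : V) :=
  forall z : V, dotp (x_ n) z @[n --> \oo] --> dotp x z.

(* A map with a domain; the values outside of [dom] are never used. *)
Record partial_fun (T U : Type) := PartialFun {
  dom : set T ;
  app :> T -> U
}.

Section operators.
Context {R : realType} {X : hilbertType R}.
Implicit Types (L : partial_fun X X) (E : R -> X -> X) (f : R -> R).
Implicit Types (x y z : X) (nu : R).

Definition linear_operator L :=
  dom L 0 /\
  forall (c : R) x y, dom L x -> dom L y ->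
    dom L (c *: x + y) /\ L (c *: x + y) = c *: L x + L y.

Definition closed_operator L :=
  forall (x_ : nat -> X) x y, (forall n, dom L (x_ n)) ->
    x_ n @[n --> \oo] --> x -> L (x_ n) @[n --> \oo] --> y ->
    dom L x /\ L x = y.

Definition unbounded_operator L :=
  ~ exists M : R, forall x, dom L x -> `|L x| <= M * `|x|.

Definition adjoint_graph L y z :=
  forall x, dom L x -> dotp (L x) y = dotp x z.

Definition self_adjoint L :=
  forall y z, adjoint_graph L y z <-> dom L y /\ L y = z.

Definition strictly_positive L :=
  (forall x, dom L x -> x != 0 -> 0 < dotp (L x) x) /\
  exists2 m : R, 0 < m & forall x, dom L x -> m * `|x| <= `|L x|.

Definition hilbert_scale_generator L :=
  [/\ linear_operator L, dense (dom L), closed_operator L & unbounded_operator L]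
  /\ self_adjoint L /\ strictly_positive L.

Definition orthogonal_projector (P : X -> X) :=
  [/\ linear P, forall x, P (P x) = P x & forall x y, dotp (P x) y = dotp x (P y)].

Definition resolution_of_identity E :=
  [/\ forall l, orthogonal_projector (E l),
      forall l k x, E l (E k x) = E (Num.min l k) x,
      forall l x, E k x @[k --> l^'+] --> E l x,
      forall x, E l x @[l --> -oo] --> (0 : X)
    & forall x, E l x @[l --> +oo] --> x].

(* y = \int_a^b f(l) dE_l x: norm limit of Riemann-Stieltjes sums over tagged
   partitions a = p 0 <= t 0 <= p 1 <= ... <= p n = b as the mesh tends to 0. *)
Definition stieltjes_integral E f (a b : R) x y :=
  forall e : R, 0 < e -> exists2 d : R, 0 < d &
    forall (n : nat) (p t : nat -> R),
      p 0%N = a -> p n = b ->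
      (forall i, (i < n)%N -> p i <= t i <= p i.+1 /\ p i.+1 - p i < d) ->
      `|\sum_(i < n) f (t i) *: (E (p i.+1) x - E (p i) x) - y| < e.

(* y = \int_{-oo}^{+oo} f(l) dE_l x; the existence of some such y characterizes
   the domain of the operator \int f dE. *)
Definition spectral_integral E f x y :=
  exists2 I : R -> X,
    forall b, 0 < b -> stieltjes_integral E f (- b) b x (I b) &
    I b @[b --> +oo] --> y.

(* E is the spectral family of L: L = \int l dE_l, domains included. *)
Definition spectral_family_of L E :=
  resolution_of_identity E /\
  forall x y, spectral_integral E id x y <-> dom L x /\ L x = y.

(* By the spectral theorem a self-adjoint L has exactly one spectral family;
   the default value given to [xget] is thus irrelevant. *)
Definition spectral_family L : R -> X -> X :=
  xget (fun _ _ => 0) [set E | spectral_family_of L E].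

(* L^nu = \int l^nu dE_l. When L is strictly positive its spectral family is 0
   on some ]-oo, m[ with m > 0, so only the values of l `^ nu at l > 0 matter. *)
Definition op_power L nu : partial_fun X X := {|
  dom := [set x | exists y,
           spectral_integral (spectral_family L) (fun l => l `^ nu) x y] ;
  app := fun x => xget 0
           [set y | spectral_integral (spectral_family L) (fun l => l `^ nu) x y]
|}.

(* The part of X_nu lying in X. For nu >= 0 this is X_nu itself; for nu < 0 it
   is the whole of X, of which X_nu is the completion. *)
Definition hscale L nu : set X := dom (op_power L nu).

(* |x|_nu for x in X, equal to +oo if x is not in X_nu. For nu < 0 the elements
   of X_nu outside of X are never needed. *)
Definition hscale_norm L nu x : \bar R :=
  if x \in hscale L nu then `|op_power L nu x|%:E else +oo%E.

Definition hscale_ball L (DF : set X) nu (mu : R) (c : X) : set X :=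
  [set f | [/\ hscale L nu f, (hscale_norm L nu (f - c)%R <= mu%:E)%E & DF f]].

End operators.

Section assumptions.
Context {R : realType} {X Y : hilbertType R}.
Implicit Types (L : partial_fun X X) (F : partial_fun X Y).

Definition locally_ill_posed F (fd : X) :=
  forall r : R, 0 < r -> exists f_ : nat -> X,
    [/\ forall n, dom F (f_ n),
        forall n, `|f_ n - fd| <= r,
        0 < limn_inf (fun n => `|f_ n - fd|)
      & `|F (f_ n) - F fd| @[n --> \oo] --> (0 : R)].

Definition weak_weak_continuous F :=
  forall (x_ : nat -> X) (x : X), (forall n, dom F (x_ n)) -> dom F x ->
    weak_cvg x_ x -> weak_cvg (fun n => F (x_ n)) (F x).

Definition unique_solution F (g : Y) (fd : X) :=
  [/\ dom F fd, F fd = g & forall f, dom F f -> F f = g -> f = fd].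

Definition basic_assumption L F (g : Y) (fd : X) (u s a : R) :=
  [/\ convex_set (dom F : set (convex_lmodType X)) /\ closed (dom F),
      weak_weak_continuous F,
      [/\ 0 < u, hscale L u fd & unique_solution F g fd]
    & [/\ 0 <= a, 0 <= s, s < u, u <= 2 * s + a & - a < s]].

(* phi is only considered on [0, +oo[. *)
Definition index_function (phi : R -> R) :=
  [/\ {within `[0, +oo[%classic, continuous phi},
      {in `[0, +oo[ &, {homo phi : x y / x < y}} & phi 0 = 0].

Definition concave_index_function (phi : R -> R) :=
  index_function phi /\
  convex_function (`[0, +oo[%classic : set (convex_lmodType R^o))
    (fun x => - phi x).

Definition conditional_stability L F (fd : X) (a : R)
    (phi : R -> R) (theta rho Rc : R) (Q : set X) :=
  [/\ concave_index_function phi,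
      [/\ 0 <= theta, 0 < rho & 0 < Rc],
      Q `<=` hscale_ball L (dom F) theta rho fd
    & forall f, Q f ->
        (hscale_norm L (- a)%R (f - fd)%R <= (Rc * phi `|F f - F fd|)%:E)%E].

Definition tikhonov L F (s alpha : R) (gd : Y) (f : X) : \bar R :=
  ((2^-1 * `|F f - gd| ^+ 2)%R%:E + alpha%:E * hscale_norm L s f ^+ 2)%E.

Definition argmin (D : set X) (T : X -> \bar R) : set X :=
  [set f | D f /\ forall h, D h -> (T f <= T h)%E].

End assumptions.

Section conjugate.
Context {R : realType}.

Definition fenchel (h : R -> \bar R) (y : R) : \bar R :=
  ereal_sup [set ((x * y)%:E - h x)%E | x in [set: R]].

Definition extend_pos (h : R -> R) (t : R) : \bar R :=
  if 0 <= t then (h t)%:E else +oo%E.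

Definition psi_usa (phi : R -> R) (u s a t : R) : R :=
  phi (Num.sqrt t) `^ (2 * (u - s) / (a + u)).

End conjugate.

(* Main.v *)
Require Import Defs.
From mathcomp Require Import all_boot all_order all_algebra.
From mathcomp Require Import all_classical all_reals all_analysis.
From mathcomp Require Import zify ring lra.

Set Implicit Arguments.
Unset Strict Implicit.
Unset Printing Implicit Defensive.

Import Order.TTheory GRing.Theory Num.Theory.
Import numFieldNormedType.Exports.

Local Open Scope classical_set_scope.
Local Open Scope ring_scope.

(** Write h = f - fd for a minimizer f, e = |h|_s, t = |F f - gd| and
D = |F f - F fd|. Comparing the Tikhonov functional at f and at fd and
expanding |f|_s^2 around fd gives

  al e^2 <= (d^2 - t^2) / 2 - 2 al <L^s fd, L^s h>.

Smoothness of fd and conditional stability meet in the mixed term: it equals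
<L^u fd, L^(2s-u) h>, and 2s-u lies between -a and s, so that with
p = (u-s)/(s+a) interpolation and stability bound it by a multiple of
|fd|_u (Rc phi(D))^p e^(1-p) (hscale_interpolation). A Young inequality
absorbs e into e^2/4 and leaves K phi(D)^(2p/(1+p)) (young_absorption). As
2p/(1+p) = 2(u-s)/(a+u), this power of phi(D) is psi(D^2). The residual
controls D, since D <= t + d implies t^2 >= D^2/3 - d^2/2; these constants
are small enough to keep the factor 1 in front of d^2/al and still leave
-D^2/(8 al) (absorbed_error_le). The remaining C psi(D^2) - D^2/(8 al) is a
competitor in the supremum that defines the conjugate. If D = 0, then f = fd
by uniqueness and there is nothing to estimate.

The facts on the Hilbert scale are read off Riemann-Stieltjes sums of the
spectral family.

- Interpolation holds for sums over a common partition, where it is an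
  inequality between powers of each tag followed by Cauchy-Schwarz, and it
  passes to the limit (spectral_integral_interpolation).

- X_u is contained in X_s. The squared distance of two sums of f over two
  unrelated partitions is an average of (f t_i - f w_j)^2 with nonnegative
  weights <P_i x, Q_j x>, a discrete coupling (dist_stieltjes_sum2). Hence,
  if the increments of f are dominated by those of h, convergence of the sums
  of h forces convergence of the sums of f, without any common refinement
  (spectral_integral_dominated). This applies to l^s = (l^u)^(s/u) when
  0 < s < u. *)

(** * Inner products *)

Section inner_product.
Context {R : realType} {V : hilbertType R}.
Implicit Types (x y z : V) (c : R).

Lemma dotpDr x y z : dotp x (y + z) = dotp x y + dotp x z.
Proof. by rewrite dotpC dotpDl ![dotp _ x]dotpC. Qed.

Lemma dotpZr c x y : dotp x (c *: y) = c * dotp x y.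
Proof. by rewrite dotpC dotpZl dotpC. Qed.

Lemma dotpNl x y : dotp (- x) y = - dotp x y.
Proof. by rewrite -scaleN1r dotpZl mulN1r. Qed.

Lemma dotpNr x y : dotp x (- y) = - dotp x y.
Proof. by rewrite dotpC dotpNl dotpC. Qed.

Lemma dotpBl x y z : dotp (x - y) z = dotp x z - dotp y z.
Proof. by rewrite dotpDl dotpNl. Qed.

Lemma dotpBr x y z : dotp x (y - z) = dotp x y - dotp x z.
Proof. by rewrite dotpDr dotpNr. Qed.

Lemma dotp0l x : dotp 0 x = 0.
Proof. by rewrite -(scale0r x) dotpZl mul0r. Qed.

Lemma dotp0r x : dotp x 0 = 0.
Proof. by rewrite dotpC dotp0l. Qed.

Lemma dotp_suml (I : Type) (r : seq I) (P : pred I) (F : I -> V) y :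
  dotp (\sum_(i <- r | P i) F i) y = \sum_(i <- r | P i) dotp (F i) y.
Proof.
by elim/big_rec2: _ => [|i a b _ <-]; rewrite ?dotp0l // dotpDl.
Qed.

Lemma dotp_sumr (I : Type) (r : seq I) (P : pred I) (F : I -> V) y :
  dotp y (\sum_(i <- r | P i) F i) = \sum_(i <- r | P i) dotp y (F i).
Proof. by rewrite dotpC dotp_suml; apply: eq_bigr => i _; rewrite dotpC. Qed.

Lemma dotpp_ge0 x : 0 <= dotp x x.
Proof. by rewrite dotpp sqr_ge0. Qed.

Lemma sqr_normD x y : `|x + y| ^+ 2 = `|x| ^+ 2 + 2 * dotp x y + `|y| ^+ 2.
Proof.
by rewrite -!dotpp dotpDl !dotpDr (dotpC y x) mulr_natl mulr2n !addrA.
Qed.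

Lemma sqr_normB x y : `|x - y| ^+ 2 = `|x| ^+ 2 - 2 * dotp x y + `|y| ^+ 2.
Proof. by rewrite sqr_normD dotpNr mulrN normrN. Qed.

Lemma cauchy_schwarz x y : dotp x y ^+ 2 <= `|x| ^+ 2 * `|y| ^+ 2.
Proof.
have [->|y0] := eqVneq y 0.
  by rewrite dotp0r normr0 !expr0n /= mulr0.
have y2 : 0 < dotp y y by rewrite dotpp exprn_gt0 // normr_gt0.
have := dotpp_ge0 (dotp y y *: x - dotp x y *: y).
rewrite -!dotpp dotpBl !dotpBr !dotpZl !dotpZr (dotpC y x).
set A := dotp x x; set B := dotp y y in y2 *; set D := dotp x y => h.
by rewrite -subr_ge0 -(pmulr_rge0 _ y2); apply: le_trans h _; lra.
Qed.

(** By polarization, the inner product inherits its continuity from the norm. *)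
Lemma cvg_dotp {T : Type} (F : set_system T) {FF : Filter F}
    (f g : T -> V) x y :
  f t @[t --> F] --> x -> g t @[t --> F] --> y ->
  dotp (f t) (g t) @[t --> F] --> dotp x y.
Proof.
move=> fx gy.
have polar (a b : V) : dotp a b =
    2^-1 * (`|a + b| * `|a + b| - `|a| * `|a| - `|b| * `|b| : R).
  by rewrite -!expr2 sqr_normD; field.
have -> : (fun t => dotp (f t) (g t)) = (fun t => 2^-1 *
    (`|f t + g t| * `|f t + g t| - `|f t| * `|f t| - `|g t| * `|g t| : R)).
  by apply/funext => t; exact: polar.
rewrite polar.
have nf : `|f t| @[t --> F] --> `|x| by exact: cvg_norm.
have ng : `|g t| @[t --> F] --> `|y| by exact: cvg_norm.
have fg : `|f t + g t| @[t --> F] --> `|x + y|.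
  by apply: cvg_norm; exact: cvgD.
apply: cvgM; first exact: cvg_cst.
exact: (cvgB (cvgB (cvgM fg fg) (cvgM nf nf)) (cvgM ng ng)).
Qed.

End inner_product.

(** * Riemann-Stieltjes sums of a family of projections *)

Section stieltjes_sums.
Context {R : realType} {X : hilbertType R}.
Implicit Types (E : R -> X -> X) (p q t w : nat -> R) (f h : R -> R) (x y : X).

Definition cell E p (i : nat) x := E (p i.+1) x - E (p i) x.

Definition stieltjes_sum E f n p t x := \sum_(i < n) f (t i) *: cell E p i x.

Definition nondecreasing_upto (n : nat) p :=
  forall i, (i < n)%N -> p i <= p i.+1.

Lemma nondecreasing_uptoP n p i j : nondecreasing_upto n p ->
  (i <= j)%N -> (j <= n)%N -> p i <= p j.
Proof.
move=> pn; elim: j => [|j IH]; first by rewrite leqn0 => /eqP ->.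
rewrite leq_eqVlt => /orP[/eqP -> //|]; rewrite ltnS => ij jn.
by apply: le_trans (IH ij (ltnW jn)) (pn _ jn).
Qed.

Lemma sum_cell E n p x : \sum_(i < n) cell E p i x = E (p n) x - E (p 0%N) x.
Proof.
by rewrite -(big_mkord xpredT (fun i => cell E p i x))
  (telescope_sumr (fun i => E (p i) x)).
Qed.

Context (E : R -> X -> X).
Context (E_proj : forall l, orthogonal_projector (E l)).
Context (E_comp : forall l k x, E l (E k x) = E (Num.min l k) x).

Lemma dotp_proj2 l k x y : dotp (E l x) (E k y) = dotp (E (Num.min l k) x) y.
Proof.
have [_ _ <-] := E_proj k.
by rewrite E_comp minC.
Qed.

(** The spectral distribution function |E_l x|^2: all the weights below are
combinations of its values. *)
Lemma mass_nondecreasing l k x : l <= k -> dotp (E l x) x <= dotp (E k x) x.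
Proof.
move=> lk; rewrite -subr_ge0 -dotpBl.
suff -> : dotp (E k x - E l x) x = dotp (E k x - E l x) (E k x - E l x).
  exact: dotpp_ge0.
rewrite dotpBl [RHS]dotpBl !dotpBr !dotp_proj2 !minxx (min_r lk) (min_l lk).
by ring.
Qed.

Lemma mass_ge0 l x : 0 <= dotp (E l x) x.
Proof. by rewrite -{1}(minxx l) -dotp_proj2 dotpp_ge0. Qed.

Lemma mass_le l x : dotp (E l x) x <= `|x| ^+ 2.
Proof.
have := dotpp_ge0 (x - E l x); rewrite dotpBl !dotpBr !dotp_proj2 minxx.
by rewrite (dotpC x) dotpp => h; lra.
Qed.

Lemma dotp_cell2 p q i j x : dotp (cell E p i x) (cell E q j x) =
  dotp (E (Num.min (p i.+1) (q j.+1)) x) x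
  - dotp (E (Num.min (p i.+1) (q j)) x) x
  - (dotp (E (Num.min (p i) (q j.+1)) x) x
     - dotp (E (Num.min (p i) (q j)) x) x).
Proof. by rewrite /cell dotpBl !dotpBr !dotp_proj2. Qed.

(** The product of two commuting projections is a projection, hence positive.
Concretely, whichever interval starts first, two of the four terms of
dotp_cell2 cancel and monotonicity of the mass decides. *)
Lemma dotp_cell_ge0 p q i j x :
  p i <= p i.+1 -> q j <= q j.+1 -> 0 <= dotp (cell E p i x) (cell E q j x).
Proof.
move=> pi qj; rewrite dotp_cell2.
have [pq|qp] := leP (p i) (q j).
- rewrite (min_l (le_trans pq qj)).
  suff : dotp (E (Num.min (p i.+1) (q j)) x) x
      <= dotp (E (Num.min (p i.+1) (q j.+1)) x) x by lra.
  by apply: mass_nondecreasing; rewrite le_min !ge_min !lexx qj !orbT.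
- rewrite (min_r (le_trans (ltW qp) pi)).
  suff : dotp (E (Num.min (p i) (q j.+1)) x) x
      <= dotp (E (Num.min (p i.+1) (q j.+1)) x) x by lra.
  by apply: mass_nondecreasing; rewrite le_min !ge_min !lexx pi !orbT.
Qed.

Lemma dotp_cell_cell p i x : p i <= p i.+1 ->
  dotp (cell E p i x) (cell E p i x) =
  dotp (E (p i.+1) x) x - dotp (E (p i) x) x.
Proof.
by move=> pi; rewrite dotp_cell2 !minxx (min_r pi) (min_l pi); ring.
Qed.

(** An interval captures at most the whole mass of a cell. *)
Lemma dotp_cell_interval p i l k x : p i <= p i.+1 -> l <= k ->
  dotp (cell E p i x) (E k x - E l x) <= dotp (cell E p i x) (cell E p i x).
Proof.
move=> pi lk; rewrite dotp_cell_cell //.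
pose q (n : nat) := if n is 0%N then l else k.
have -> : E k x - E l x = cell E q 0 x by [].
rewrite dotp_cell2 /q /=.
have G1 : dotp (E (Num.min (p i) l) x) x <= dotp (E (Num.min (p i.+1) l) x) x.
  by apply: mass_nondecreasing; rewrite le_min !ge_min !lexx pi !orbT.
have [pk|kp] := leP (p i.+1) k.
  by rewrite (min_l (le_trans pi pk)); lra.
have G2 : dotp (E k x) x <= dotp (E (p i.+1) x) x.
  by apply: mass_nondecreasing; exact: ltW.
have [pk|kp'] := leP (p i) k; first by lra.
have G3 := mass_nondecreasing x pi.
by lra.
Qed.

Lemma dotp_cell_neq n p i j x y : nondecreasing_upto n p ->
  (i < n)%N -> (j < n)%N -> i != j -> dotp (cell E p i x) (cell E p j y) = 0.
Proof.
move=> pn; wlog ij : i j x y / (i < j)%N => [hw|] i_n j_n.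
  rewrite neq_ltn => /orP[] ij; last rewrite dotpC.
    by apply: hw => //; rewrite neq_ltn ij.
  by apply: hw => //; rewrite neq_ltn ij.
have pij : p i.+1 <= p j by apply: (nondecreasing_uptoP pn) => //; exact: ltnW.
have pi : p i <= p i.+1 by exact: pn.
have pj : p j <= p j.+1 by exact: pn.
rewrite /cell dotpBl !dotpBr !dotp_proj2 !min_l ?subrr //.
- exact: le_trans pij.
- by apply: le_trans pi _; exact: le_trans pj.
- exact: le_trans pj.
Qed.

Lemma dotp_stieltjes_sum f h n p t x y : nondecreasing_upto n p ->
  dotp (stieltjes_sum E f n p t x) (stieltjes_sum E h n p t y) =
  \sum_(i < n) f (t i) * h (t i) * dotp (cell E p i x) (cell E p i y).
Proof.
move=> pn; rewrite dotp_suml; apply: eq_bigr => i _.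
rewrite dotp_sumr (bigD1 i) //= big1 ?addr0 => [|j ji].
  by rewrite dotpZl dotpZr mulrA.
by rewrite dotpZl dotpZr (dotp_cell_neq _ _ pn) ?mulr0 // eq_sym.
Qed.

Lemma normr_stieltjes_sum2 f n p t x : nondecreasing_upto n p ->
  `|stieltjes_sum E f n p t x| ^+ 2 =
  \sum_(i < n) f (t i) ^+ 2 * dotp (cell E p i x) (cell E p i x).
Proof.
by move=> pn; rewrite -dotpp dotp_stieltjes_sum //; apply: eq_bigr.
Qed.

Lemma sum_cell_mass_le n p x : nondecreasing_upto n p ->
  \sum_(i < n) dotp (cell E p i x) (cell E p i x) <= `|x| ^+ 2.
Proof.
move=> pn.
rewrite (eq_bigr (fun i : 'I_n => dotp (cell E p i x) x)) => [|i _].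
  rewrite -dotp_suml sum_cell dotpBl.
  by have := mass_le (p n) x; have := mass_ge0 (p 0%N) x; lra.
by rewrite dotp_cell_cell ?dotpBl //; exact: pn.
Qed.

(** The mass of a cell of [p] that lies outside of the range covered by [q];
with it, partitions of different intervals can be compared. *)
Definition overhang p m q (i : nat) x :=
  dotp (cell E p i x) (cell E p i x)
  - \sum_(j < m) dotp (cell E p i x) (cell E q j x).

Lemma overhang_ge0 n p m q i x : nondecreasing_upto n p ->
  nondecreasing_upto m q -> (i < n)%N -> 0 <= overhang p m q i x.
Proof.
move=> pn qm i_n; rewrite subr_ge0 -dotp_sumr sum_cell.
by apply: dotp_cell_interval; [exact: pn | exact: (nondecreasing_uptoP qm)].
Qed.

(** The weights <P_i x, Q_j x> couple the two partitions: their sums over j and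
over i are, up to overhangs, the masses |P_i x|^2 and |Q_j x|^2, so the cross
terms of the squared norm complete squares. *)
Lemma dist_stieltjes_sum2 f n p t m q w x :
  nondecreasing_upto n p -> nondecreasing_upto m q ->
  `|stieltjes_sum E f n p t x - stieltjes_sum E f m q w x| ^+ 2 =
  \sum_(i < n) \sum_(j < m)
     (f (t i) - f (w j)) ^+ 2 * dotp (cell E p i x) (cell E q j x)
  + \sum_(i < n) f (t i) ^+ 2 * overhang p m q i x
  + \sum_(j < m) f (w j) ^+ 2 * overhang q n p j x.
Proof.
move=> pn qm; rewrite sqr_normB !normr_stieltjes_sum2 //.
pose c (i : 'I_n) (j : 'I_m) := dotp (cell E p i x) (cell E q j x).
have -> : dotp (stieltjes_sum E f n p t x) (stieltjes_sum E f m q w x) =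
    \sum_(i < n) \sum_(j < m) f (t i) * f (w j) * c i j.
  rewrite dotp_suml; apply: eq_bigr => i _; rewrite dotp_sumr.
  by apply: eq_bigr => j _; rewrite dotpZl dotpZr mulrA.
have -> : \sum_(i < n) \sum_(j < m) (f (t i) - f (w j)) ^+ 2 * c i j =
    \sum_(i < n) f (t i) ^+ 2 * (\sum_(j < m) c i j)
    - 2 * (\sum_(i < n) \sum_(j < m) f (t i) * f (w j) * c i j)
    + \sum_(j < m) f (w j) ^+ 2 * (\sum_(i < n) c i j).
  under [X in _ = _ + X]eq_bigr do rewrite mulr_sumr.
  rewrite [X in _ = _ + X]exchange_big /= mulr_sumr -sumrB -big_split /=.
  apply: eq_bigr => i _; rewrite !mulr_sumr -sumrB -big_split /=.
  by apply: eq_bigr => j _; ring.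
have -> : \sum_(i < n) f (t i) ^+ 2 * overhang p m q i x =
    \sum_(i < n) f (t i) ^+ 2 * dotp (cell E p i x) (cell E p i x)
    - \sum_(i < n) f (t i) ^+ 2 * (\sum_(j < m) c i j).
  by rewrite -sumrB; apply: eq_bigr => i _; rewrite mulrBr.
have -> : \sum_(j < m) f (w j) ^+ 2 * overhang q n p j x =
    \sum_(j < m) f (w j) ^+ 2 * dotp (cell E q j x) (cell E q j x)
    - \sum_(j < m) f (w j) ^+ 2 * (\sum_(i < n) c i j).
  rewrite -sumrB; apply: eq_bigr => j _; rewrite mulrBr; congr (_ - _ * _).
  by apply: eq_bigr => i _; rewrite dotpC.
by ring.
Qed.

(** Termwise estimate in dist_stieltjes_sum2. The coupling and the overhangs
have total mass at most 2 |x|^2, because each partition has mass at most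
|x|^2. *)
Lemma dist_stieltjes_sum2_le f h (e K : R) n p t m q w x : 0 <= e ->
  (forall a b, (f a - f b) ^+ 2 <= e + K * (h a - h b) ^+ 2) ->
  (forall a, f a ^+ 2 <= e + K * h a ^+ 2) ->
  nondecreasing_upto n p -> nondecreasing_upto m q ->
  `|stieltjes_sum E f n p t x - stieltjes_sum E f m q w x| ^+ 2 <=
  e * (2 * `|x| ^+ 2)
  + K * `|stieltjes_sum E h n p t x - stieltjes_sum E h m q w x| ^+ 2.
Proof.
move=> e0 fh2 fh1 pn qm; rewrite !dist_stieltjes_sum2 //.
pose c (i : 'I_n) (j : 'I_m) := dotp (cell E p i x) (cell E q j x).
have c_ge0 i j : 0 <= c i j.
  by apply: dotp_cell_ge0; [exact: pn | exact: qm].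
have le1 : \sum_(i < n) \sum_(j < m) (f (t i) - f (w j)) ^+ 2 * c i j <=
    e * (\sum_(i < n) \sum_(j < m) c i j)
    + K * (\sum_(i < n) \sum_(j < m) (h (t i) - h (w j)) ^+ 2 * c i j).
  rewrite !mulr_sumr -big_split /=; apply: ler_sum => i _.
  rewrite !mulr_sumr -big_split /=; apply: ler_sum => j _.
  by rewrite mulrA -mulrDl ler_wpM2r.
have le2 : \sum_(i < n) f (t i) ^+ 2 * overhang p m q i x <=
    e * (\sum_(i < n) overhang p m q i x)
    + K * (\sum_(i < n) h (t i) ^+ 2 * overhang p m q i x).
  rewrite !mulr_sumr -big_split /=; apply: ler_sum => i _.
  by rewrite mulrA -mulrDl ler_wpM2r // (overhang_ge0 _ pn qm).
have le3 : \sum_(j < m) f (w j) ^+ 2 * overhang q n p j x <=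
    e * (\sum_(j < m) overhang q n p j x)
    + K * (\sum_(j < m) h (w j) ^+ 2 * overhang q n p j x).
  rewrite !mulr_sumr -big_split /=; apply: ler_sum => i _.
  by rewrite mulrA -mulrDl ler_wpM2r // (overhang_ge0 _ qm pn).
have mass1 : \sum_(i < n) \sum_(j < m) c i j
    + \sum_(i < n) overhang p m q i x <= `|x| ^+ 2.
  rewrite -big_split /=; apply: le_trans (sum_cell_mass_le x pn).
  by apply: ler_sum => i _; rewrite addrC subrK.
have mass2 : \sum_(j < m) overhang q n p j x <= `|x| ^+ 2.
  apply: le_trans (sum_cell_mass_le x qm); apply: ler_sum => j _.
  rewrite gerBl sumr_ge0 // => i _; rewrite dotpC; exact: c_ge0.
have := ler_wpM2l e0 mass1; have := ler_wpM2l e0 mass2.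
move: le1 le2 le3; rewrite /c !mulrDr; lra.
Qed.

End stieltjes_sums.

(** * Inequalities between powers *)

Section powers.
Context {R : realType}.
Implicit Types (A B P Q p r : R).

(** A crude form of the weighted arithmetic-geometric inequality: both factors
are bounded by powers of the sum. It replaces Young's inequality wherever the
constant is irrelevant. *)
Lemma powRM_le_addr A B p r :
  0 <= A -> 0 <= B -> 0 <= p -> 0 <= r -> 0 < p + r ->
  A `^ p * B `^ r <= (A + B) `^ (p + r).
Proof.
move=> A0 B0 p0 r0 pr; rewrite powRD ?(gt_eqF pr) //.
by apply: ler_pM; rewrite ?powR_ge0 // ge0_ler_powR ?nnegrE ?addr_ge0 //;
  rewrite ?lerDl ?lerDr.
Qed.

(** Hoelder's inequality linearized around a reference point (P, Q): the right
side is additive in (A, B), so it can be summed and passed to the limit, and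
choosing for P and Q the final values of A and B gives back the product of
powers up to a factor 2. *)
Lemma powR_interpolation A B P Q p : 0 <= A -> 0 <= B -> 0 < P -> 0 < Q ->
  0 <= p <= 1 ->
  A `^ p * B `^ (1 - p) <= P `^ p * Q `^ (1 - p) * (A / P + B / Q).
Proof.
move=> A0 B0 P0 Q0 /andP[p0 p1].
have AP : 0 <= A / P by rewrite divr_ge0 // ltW.
have BQ : 0 <= B / Q by rewrite divr_ge0 // ltW.
rewrite -[A in leLHS](divfK (lt0r_neq0 P0)) -[B in leLHS](divfK (lt0r_neq0 Q0)).
rewrite (powRM _ AP (ltW P0)) (powRM _ BQ (ltW Q0)).
rewrite mulrACA mulrC ler_wpM2l ?mulr_ge0 ?powR_ge0 //.
have p1' : 0 <= 1 - p by rewrite subr_ge0.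
have := powRM_le_addr AP BQ p0 p1'.
have -> : p + (1 - p) = 1 by ring.
by rewrite powRr1 ?addr_ge0 //; apply.
Qed.

(** Each share c = C / (A + B) of the sum lies in [0, 1], where c <= c^r. *)
Lemma powR_subadditive A B r : 0 <= A -> 0 <= B -> 0 < r <= 1 ->
  (A + B) `^ r <= A `^ r + B `^ r.
Proof.
move=> A0 B0 /andP[r0 r1].
have [A_eq0|A_neq0] := eqVneq A 0.
  by rewrite A_eq0 add0r lerDr powR_ge0.
have [B_eq0|B_neq0] := eqVneq B 0.
  by rewrite B_eq0 addr0 lerDl powR_ge0.
have Apos : 0 < A by rewrite lt_def A_neq0.
have Bpos : 0 < B by rewrite lt_def B_neq0.
have S0 : 0 < A + B by exact: addr_gt0.
have part C : 0 < C <= A + B -> (A + B) `^ r * (C / (A + B)) <= C `^ r.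
  move=> /andP[C0 CS].
  rewrite -[C in leRHS](divfK (lt0r_neq0 S0)).
  rewrite powRM ?(ltW S0) ?divr_ge0 ?(ltW S0) ?(ltW C0) //.
  rewrite mulrC ler_wpM2r ?powR_ge0 // ger1_powR // divr_gt0 //=.
  by rewrite ler_pdivrMr // mul1r.
apply: le_trans (lerD (part A _) (part B _)); last 2 first.
- by rewrite Apos lerDl ltW.
- by rewrite Bpos lerDr ltW.
by rewrite -mulrDr -mulrDl divff ?mulr1 // gt_eqF.
Qed.

Lemma powR_dist_le A B r : 0 <= A -> 0 <= B -> 0 < r <= 1 ->
  `|A `^ r - B `^ r| <= `|A - B| `^ r.
Proof.
wlog BA : A B / B <= A => [hw|] A0 B0 r01.
  have [BA|/ltW AB] := leP B A; first exact: hw.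
  by rewrite distrC (distrC A); exact: hw.
have AB0 : 0 <= A - B by rewrite subr_ge0.
have := powR_subadditive AB0 B0 r01; rewrite subrK => h.
rewrite (ger0_norm AB0) ger0_norm ?lerBlDr // subr_ge0.
by case/andP: r01 => r0 _; rewrite ge0_ler_powR ?nnegrE // ltW.
Qed.

(** A concave power lies below e near 0; beyond the point n where z^r = e, it is
below the line through (n, e) and the origin. *)
Lemma powR_le_linear (e : R) r : 0 < e -> 0 < r <= 1 ->
  exists2 K : R, 0 <= K & forall z, 0 <= z -> z `^ r <= e + K * z.
Proof.
move=> e0 /andP[r0 r1].
pose n := e `^ r^-1; have n0 : 0 < n by exact: powR_gt0.
have nr : n `^ r = e by rewrite -powRrM mulVf ?gt_eqF // powRr1 // ltW.
exists (e / n) => [|z z0]; first by rewrite divr_ge0 ?ltW.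
have [zn|nz] := leP z n.
  rewrite -[leLHS]addr0 lerD //; last by rewrite mulr_ge0 // divr_ge0 ?ltW.
  by rewrite -nr ge0_ler_powR ?nnegrE // ltW.
rewrite -[leLHS]add0r lerD ?(ltW e0) //.
have zn1 : 1 <= z / n by rewrite ler_pdivlMr // mul1r ltW.
rewrite -[z in leLHS](divfK (lt0r_neq0 n0)).
rewrite powRM ?(ltW n0) ?divr_ge0 ?(ltW n0) //.
rewrite nr mulrC mulrAC -mulrA ler_wpM2l ?(ltW e0) //.
exact: ler1_powR.
Qed.

Lemma powR_sqr_dist_le (e : R) r : 0 < e -> 0 < r < 1 ->
  exists2 K : R, 0 <= K & forall A B, 0 <= A -> 0 <= B ->
    (A `^ r - B `^ r) ^+ 2 <= e + K * (A - B) ^+ 2.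
Proof.
move=> e0 /andP[r0 r1].
have r01 : 0 < r <= 1 by rewrite r0 ltW.
have [K K0 hK] := powR_le_linear e0 r01.
exists K => // A B A0 B0.
rewrite -[X in X <= _]real_normK ?num_real //.
rewrite -[X in _ * X]real_normK ?num_real //.
apply: le_trans (hK _ (sqr_ge0 _)).
rewrite -[X in _ <= X `^ _]powR_mulrn // -powRrM mulrC powRrM.
rewrite powR_mulrn ?powR_ge0 //.
by rewrite lerXn2r ?nnegrE ?powR_ge0 // powR_dist_le.
Qed.

End powers.

(** * Uniqueness and linearity of the spectral integral *)

Section spectral_integrals.
Context {R : realType} {X : hilbertType R}.
Implicit Types (E : R -> X -> X) (f h : R -> R) (x y z : X) (b : R).

(** The uniform partition of [-b, b] into 2 (k + 1) cells, tagged by midpoints.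
The number of cells being even, no tag is 0, where the laws of exponents for
[`^] break down. *)
Definition uniform_node b (k i : nat) : R := b / k.+1%:R * (i%:R - k.+1%:R).

Definition uniform_tag b (k i : nat) : R :=
  b / k.+1%:R * (i%:R + 2^-1 - k.+1%:R).

Lemma uniform_tag_neq0 b k i : 0 < b -> uniform_tag b k i != 0.
Proof.
move=> b0; rewrite mulf_neq0 // ?(gt_eqF (divr_gt0 _ _)) //.
apply/eqP => h.
have /eqP : (2 * i + 1)%:R = (2 * k.+1)%:R :> R.
  by rewrite natrD !natrM; lra.
rewrite eqr_nat => /eqP; lia.
Qed.

Lemma uniform_node_tag b k i : 0 < b ->
  uniform_node b k i <= uniform_tag b k i <= uniform_node b k i.+1.
Proof.
move=> b0; have w0 : 0 <= b / k.+1%:R by rewrite divr_ge0 // ltW.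
rewrite /uniform_node /uniform_tag -[i.+1%:R]natr1 !ler_wpM2l //; lra.
Qed.

Lemma uniform_node_nondecreasing b k n : 0 < b ->
  nondecreasing_upto n (uniform_node b k).
Proof.
by move=> b0 i _; case/andP: (uniform_node_tag k i b0); exact: le_trans.
Qed.

Definition uniform_sum E f b k x :=
  stieltjes_sum E f (2 * k.+1) (uniform_node b k) (uniform_tag b k) x.

Lemma cvg_uniform_sum E f b x y : 0 < b -> stieltjes_integral E f (- b) b x y ->
  uniform_sum E f b k x @[k --> \oo] --> y.
Proof.
move=> b0 I; apply/cvgrPdist_lt => e e0.
have [d d0 Id] := I e e0.
near=> k.
rewrite distrC; apply: Id.
- by rewrite /uniform_node sub0r mulrN divfK // pnatr_eq0.
- rewrite /uniform_node.
  have -> : (2 * k.+1)%:R = k.+1%:R + k.+1%:R :> R.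
    by rewrite -natrD mul2n addnn.
  by rewrite addrK divfK // pnatr_eq0.
- move=> i _; have /andP[h1 h2] := uniform_node_tag k i b0.
  split; first by rewrite h1.
  rewrite /uniform_node -[i.+1%:R]natr1 -mulrBr.
  have -> : i%:R + 1 - k.+1%:R - (i%:R - k.+1%:R) = 1 :> R by ring.
  rewrite mulr1 ltr_pdivrMr // mulrC -ltr_pdivrMr //.
  near: k; apply: filterS (nbhs_infty_gtr (b / d)) => k /lt_trans; apply.
  by rewrite ltr_nat.
Unshelve. all: by end_near. Qed.

(** Each truncated integral is the limit of its uniform sums, so limits in a
Hausdorff space identify it. *)
Lemma spectral_integral_unique E f x y z :
  spectral_integral E f x y -> spectral_integral E f x z -> y = z.
Proof.
move=> [I Ix Iy] [J Jx Jz].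
have IJ b : 0 < b -> I b = J b.
  move=> b0.
  exact: norm_cvg_unique (cvg_uniform_sum b0 (Ix b b0))
                         (cvg_uniform_sum b0 (Jx b b0)).
apply: norm_cvg_unique Iy _.
apply: cvg_trans Jz; apply: near_eq_cvg.
by apply: filterS (nbhs_pinfty_gt (num_real 0)) => b /IJ ->.
Qed.

Lemma stieltjes_integralB E f a b x y x' y' :
  (forall l, orthogonal_projector (E l)) ->
  stieltjes_integral E f a b x y -> stieltjes_integral E f a b x' y' ->
  stieltjes_integral E f a b (x - x') (y - y').
Proof.
move=> E_proj I I' e e0.
have e2 : 0 < e / 2 by lra.
have [d d0 Id] := I _ e2; have [d' d'0 Id'] := I' _ e2.
exists (Num.min d d') => [|n p t pa pb pt]; first by rewrite lt_min d0.
have EB l v w : E l (v - w) = E l v - E l w.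
  have [linE _ _] := E_proj l.
  by rewrite -[v - w]addrC -scaleN1r linE scaleN1r addrC.
have -> : \sum_(i < n) f (t i) *: (E (p i.+1) (x - x') - E (p i) (x - x'))
    - (y - y')
  = (\sum_(i < n) f (t i) *: (E (p i.+1) x - E (p i) x) - y)
  - (\sum_(i < n) f (t i) *: (E (p i.+1) x' - E (p i) x') - y').
  rewrite !opprD addrACA -!opprD -sumrB; congr (_ - _).
  by apply: eq_bigr => i _; rewrite -scalerBr !EB !opprD addrACA.
apply: le_lt_trans (ler_normB _ _) _.
rewrite [e]splitr; apply: ltrD.
- apply: Id => // i /pt[h]; rewrite lt_min => /andP[]; by split.
- apply: Id' => // i /pt[h]; rewrite lt_min => /andP[]; by split.
Qed.

Lemma spectral_integralB E f x y x' y' :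
  (forall l, orthogonal_projector (E l)) ->
  spectral_integral E f x y -> spectral_integral E f x' y' ->
  spectral_integral E f (x - x') (y - y').
Proof.
move=> E_proj [I Ix Iy] [I' Ix' Iy'].
exists (fun b => I b - I' b); last exact: cvgB.
by move=> b b0; apply: stieltjes_integralB; [|exact: Ix|exact: Ix'].
Qed.

End spectral_integrals.

(** * Existence of spectral integrals by domination of oscillations *)

Section domination.
Context {R : realType} {X : hilbertType R}.
Implicit Types (E : R -> X -> X) (f h : R -> R) (x y z : X) (b : R).

Lemma ltr_sqr_norm (e : R) x : 0 < e -> `|x| ^+ 2 < e ^+ 2 -> `|x| < e.
Proof. by move=> e0; rewrite ltr_pXn2r // nnegrE ?(ltW e0). Qed.

Definition dist2_dominated (T : Type) (P : set T) (u v : T -> X) :=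
  forall e : R, 0 < e -> exists2 K : R, 0 <= K & forall s t, P s -> P t ->
    `|u s - u t| ^+ 2 <= e + K * `|v s - v t| ^+ 2.

Lemma dominated_radius (e K : R) : 0 < e -> 0 <= K ->
  exists2 r : R, 0 < r & K * r ^+ 2 < e ^+ 2 / 2.
Proof.
move=> e0 K0; exists (e / (2 * (1 + K))) => [|].
  by rewrite divr_gt0 // mulr_gt0 //; lra.
rewrite expr_div_n mulrA ltr_pdivrMr ?exprn_gt0 //; last by lra.
have e2 : 0 < e ^+ 2 by rewrite exprn_gt0.
have : 0 < e ^+ 2 * (2 + 3 * K + 2 * K ^+ 2).
  by rewrite mulr_gt0 //; have := sqr_ge0 K; lra.
lra.
Qed.

Lemma cvg_dominated (T : Type) (F : set_system T) {FF : ProperFilter F}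
    (P : set T) (u v : T -> X) :
  F P -> dist2_dominated P u v -> cvg (v t @[t --> F]) -> cvg (u t @[t --> F]).
Proof.
move=> FP uv /cvg_ex[l vl]; apply: cauchy_cvg; apply: cauchy_exP => e e0.
have e2 : 0 < e ^+ 2 / 2 by rewrite divr_gt0 ?exprn_gt0.
have [K K0 uvK] := uv _ e2.
have [r r0 Kr] := dominated_radius e0 K0.
have r2 : 0 < r / 2 by lra.
have Fv : F (fun t => P t /\ `|l - v t| < r / 2).
  by apply: filterI => //; move/cvgrPdist_lt: vl => /(_ _ r2).
have [s [Ps vs]] := filter_ex Fv.
exists (u s); suff : F [set t | ball (u s) e (u t)] by [].
apply: filterS Fv => t [Pt vt].
rewrite -ball_normE /=; apply: ltr_sqr_norm => //.
apply: le_lt_trans (uvK _ _ Ps Pt) _.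
rewrite [ltRHS]splitr ltrD2l; apply: le_lt_trans Kr.
rewrite ler_wpM2l // lerXn2r ?nnegrE ?(ltW r0) //.
rewrite [r]splitr -[v s](subrK l) -addrA; apply: le_trans (ler_normD _ _) _.
by rewrite lerD // ?ltW // distrC.
Qed.

Context (E : R -> X -> X).
Context (E_proj : forall l, orthogonal_projector (E l)).
Context (E_comp : forall l k x, E l (E k x) = E (Num.min l k) x).

(** Equivalently, when h has an interval containing 0 as range, f is a uniformly
continuous function of h that maps 0 to 0. The second clause is what controls
the parts of two partitions that do not overlap. *)
Definition oscillation_dominated f h :=
  forall e : R, 0 < e -> exists2 K : R, 0 <= K &
    (forall a b, (f a - f b) ^+ 2 <= e + K * (h a - h b) ^+ 2)
    /\ (forall a, f a ^+ 2 <= e + K * h a ^+ 2).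

(** The constants do not depend on the tagged partitions, whatever the intervals
they cover: this single estimate yields convergence both as the mesh tends to
0 and as the interval grows. *)
Lemma dist_sum_dominated f h x : oscillation_dominated f h ->
  dist2_dominated
    [set s : nat * (nat -> R) * (nat -> R) | nondecreasing_upto s.1.1 s.1.2]
    (fun s => stieltjes_sum E f s.1.1 s.1.2 s.2 x)
    (fun s => stieltjes_sum E h s.1.1 s.1.2 s.2 x).
Proof.
move=> fh e e0.
have x2 : 0 <= `|x| ^+ 2 by exact: sqr_ge0.
have D0 : 0 < 2 * (1 + `|x| ^+ 2) by lra.
have [K K0 [fh2 fh1]] := fh (e / (2 * (1 + `|x| ^+ 2))) (divr_gt0 e0 D0).
exists K => // -[[n p] t] [[m q] w] /= pn qm.
apply: le_trans (dist_stieltjes_sum2_le E_proj E_comp t w x _ fh2 fh1 pn qm) _.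
  by rewrite divr_ge0 // ltW.
rewrite lerD2r -mulrA ger_pMr // ler_pdivrMl //; lra.
Qed.

Lemma cvg_norm_dist2 (T : Type) (F : set_system T) {FF : Filter F}
    (u v : T -> X) y z : u t @[t --> F] --> y -> v t @[t --> F] --> z ->
  `|u t - v t| ^+ 2 @[t --> F] --> (`|y - z| ^+ 2 : R).
Proof.
move=> uy vz; have d : `|u t - v t| @[t --> F] --> `|y - z|.
  by apply: cvg_norm; exact: cvgB.
by rewrite expr2; under eq_fun do rewrite expr2; exact: cvgM.
Qed.

Lemma le_cvg_dist2 (T : topologicalType) (F : set_system T)
    {FF : ProperFilter F} (u u' v v' : T -> X) (e K : R) y y' z z' :
  u t @[t --> F] --> y -> u' t @[t --> F] --> y' ->
  v t @[t --> F] --> z -> v' t @[t --> F] --> z' ->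
  (forall t, `|u t - u' t| ^+ 2 <= e + K * `|v t - v' t| ^+ 2) ->
  `|y - y'| ^+ 2 <= e + K * `|z - z'| ^+ 2.
Proof.
move=> uy uy' vz vz' le_uv.
have rhs : e + K * `|v t - v' t| ^+ 2 @[t --> F] --> e + K * `|z - z'| ^+ 2.
  apply: cvgD; first exact: cvg_cst.
  by apply: cvgM; [exact: cvg_cst | exact: cvg_norm_dist2].
have lhs : `|u t - u' t| ^+ 2 @[t --> F] --> (`|y - y'| ^+ 2 : R).
  exact: cvg_norm_dist2.
by apply: (ler_cvg_to lhs rhs); near=> t; exact: le_uv.
Unshelve. all: by end_near.
Qed.

Definition uniform_partition b (k : nat) :=
  ((2 * k.+1)%N, uniform_node b k, uniform_tag b k).

(** The candidate for the integral of f is the limit of its uniform sums. Any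
fine sum is close to it, as is seen by comparing it with uniform sums. *)
Lemma stieltjes_integral_dominated f h b x y : oscillation_dominated f h ->
  0 < b -> stieltjes_integral E h (- b) b x y ->
  exists z, stieltjes_integral E f (- b) b x z.
Proof.
move=> fh b0 hy; have hu := cvg_uniform_sum b0 hy.
have dom := dist_sum_dominated x fh.
have nd k : nondecreasing_upto (2 * k.+1) (uniform_node b k).
  exact: uniform_node_nondecreasing.
have /cvg_ex[z fu] : cvg (uniform_sum E f b k x @[k --> \oo]).
  apply: (@cvg_dominated _ _ _ setT _ (fun k => uniform_sum E h b k x)).
  - exact: filterT.
  - move=> e e0; have [K K0 hK] := dom e e0; exists K => // k l _ _.
    exact: (hK (uniform_partition b k) (uniform_partition b l) (nd k) (nd l)).
  - by apply/cvg_ex; exists y.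
exists z => e e0.
have e2 : 0 < e ^+ 2 / 2 by rewrite divr_gt0 ?exprn_gt0.
have [K K0 hK] := dom _ e2.
have [r r0 Kr] := dominated_radius e0 K0.
have [d d0 hd] := hy r r0; exists d => // n p t pa pb pt.
have pn : nondecreasing_upto n p.
  by move=> i /pt[/andP[h1 h2] _]; exact: le_trans h2.
apply: ltr_sqr_norm => //.
apply: (@le_lt_trans _ _
    (e ^+ 2 / 2 + K * `|stieltjes_sum E h n p t x - y| ^+ 2)).
  apply: (le_cvg_dist2 (cvg_cst _) fu (cvg_cst _) hu) => k.
  exact: (hK (n, p, t) (uniform_partition b k) pn (nd k)).
rewrite [ltRHS]splitr ltrD2l.
apply: le_lt_trans Kr; rewrite ler_wpM2l // lerXn2r ?nnegrE ?(ltW r0) //.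
by apply/ltW/hd.
Qed.

(** Sums over [-b, b] and [-c, c] are compared on uniform partitions of the same
index k, so that one limit in k gives the estimate between the integrals. *)
Lemma spectral_integral_dominated f h x y : oscillation_dominated f h ->
  spectral_integral E h x y -> exists z, spectral_integral E f x z.
Proof.
move=> fh [I hI Iy].
have exJ b : exists z, 0 < b -> stieltjes_integral E f (- b) b x z.
  have [b0|b0] := boolP (0 < b); last by exists 0.
  by have [z hz] := stieltjes_integral_dominated fh b0 (hI b b0); exists z.
have [J hJ] := choice exJ.
suff /cvg_ex[z Jz] : cvg (J b @[b --> +oo]) by exists z, J.
apply: (@cvg_dominated _ _ _ [set b | 0 < b] _ I).
- exact: nbhs_pinfty_gt (num_real 0).
- move=> e e0; have [K K0 hK] := dist_sum_dominated x fh e0.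
  exists K => // b c b0 c0.
  apply: le_cvg_dist2
    (cvg_uniform_sum b0 (hJ b b0)) (cvg_uniform_sum c0 (hJ c c0))
    (cvg_uniform_sum b0 (hI b b0)) (cvg_uniform_sum c0 (hI c c0)) _ => k.
  by apply: (hK (uniform_partition b k) (uniform_partition c k));
    exact: uniform_node_nondecreasing.
- by apply/cvg_ex; exists y.
Qed.

(** l^s = (l^u)^(s/u) for every real l, and z^(s/u) is uniformly continuous and
vanishes at 0. *)
Lemma oscillation_dominated_powR (s u : R) : 0 < s < u ->
  oscillation_dominated (fun l => l `^ s) (fun l => l `^ u).
Proof.
move=> /andP[s0 su] e e0; have u0 : 0 < u by exact: lt_trans su.
have r01 : 0 < s / u < 1 by rewrite divr_gt0 //= ltr_pdivrMr // mul1r.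
have [K K0 hK] := powR_sqr_dist_le e0 r01.
have sE a : a `^ s = (a `^ u) `^ (s / u).
  by rewrite -powRrM mulrC divfK // gt_eqF.
exists K => //; split=> [a b|a]; rewrite !sE.
  exact: hK (powR_ge0 _ _) (powR_ge0 _ _).
have := hK (a `^ u) 0 (powR_ge0 _ _) (lexx _).
by rewrite powR0 ?gt_eqF ?divr_gt0 // !subr0.
Qed.

(** For the constant function 1, every sum telescopes to E_b x - E_(-b) x. *)
Lemma spectral_integral_powR0 x (l_ l' : X) :
  E l x @[l --> -oo] --> l_ -> E l x @[l --> +oo] --> l' ->
  exists z, spectral_integral E (fun l => l `^ 0) x z.
Proof.
move=> Em Ep; exists (l' - l_); exists (fun b => E b x - E (- b) x).
  move=> b b0 e e0; exists 1 => // n p t pa pb _.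
  rewrite (eq_bigr (fun i : 'I_n => cell E p i x)) => [|i _].
    by rewrite sum_cell pa pb subrr normr0.
  by rewrite powRr0 scale1r.
apply: cvgB => //; apply: cvg_comp Em.
move=> A [M [Mr hM]]; exists (- M); split; first by rewrite num_real.
by move=> b /= hb; apply: hM; rewrite ltrNl.
Qed.

End domination.

(** * The interpolation inequality *)

Section interpolation.
Context {R : realType} {X : hilbertType R}.
Context (E : R -> X -> X).
Context (E_proj : forall l, orthogonal_projector (E l)).
Context (E_comp : forall l k x, E l (E k x) = E (Num.min l k) x).
Context (s u a : R) (as_gt0 : 0 < s + a) (su : s <= u) (usa : u <= 2 * s + a).

Let p := (u - s) / (s + a).

Lemma interpolation_exponent : 0 <= p <= 1.
Proof.
rewrite /p divr_ge0 ?subr_ge0 ?(ltW as_gt0) //= ler_pdivrMr //.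
by rewrite mul1r lerBlDr addrAC -mulr2n -mulr_natl.
Qed.

(** The exponent 2 s - u is the convex combination of - a and s with weights p
and 1 - p. *)
Lemma powR_sqr_interpolation (P Q l : R) : l != 0 -> 0 < P -> 0 < Q ->
  (l `^ (2 * s - u)) ^+ 2 <=
  P `^ p * Q `^ (1 - p) * ((l `^ (- a)) ^+ 2 / P + (l `^ s) ^+ 2 / Q).
Proof.
move=> l0 P0 Q0.
have -> : 2 * s - u = - a * p + s * (1 - p).
  by rewrite /p; field; rewrite gt_eqF.
rewrite powRD ?l0 ?implybT // (powRrM l (- a)) (powRrM l s) exprMn.
have sqr_powR (b r : R) : 0 <= b -> (b `^ r) ^+ 2 = (b ^+ 2) `^ r.
  by move=> b0; rewrite !expr2 powRM.
rewrite (sqr_powR (l `^ (- a))) ?powR_ge0 //.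
rewrite (sqr_powR (l `^ s)) ?powR_ge0 //.
by apply: powR_interpolation => //; rewrite ?sqr_ge0 // interpolation_exponent.
Qed.

(** Cells being orthogonal, powers of the tags can be moved from one argument of
the inner product to the other. *)
Lemma dotp_stieltjes_sum_interpolation (P Q : R) n q t x z :
  nondecreasing_upto n q -> (forall i, t i != 0) -> 0 < P -> 0 < Q ->
  dotp (stieltjes_sum E (fun l => l `^ s) n q t x)
       (stieltjes_sum E (fun l => l `^ s) n q t z) ^+ 2 <=
  `|stieltjes_sum E (fun l => l `^ u) n q t x| ^+ 2 *
  (P `^ p * Q `^ (1 - p) *
   (`|stieltjes_sum E (fun l => l `^ (- a)) n q t z| ^+ 2 / P +
    `|stieltjes_sum E (fun l => l `^ s) n q t z| ^+ 2 / Q)).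
Proof.
move=> qn t0 P0 Q0.
have -> : dotp (stieltjes_sum E (fun l => l `^ s) n q t x)
      (stieltjes_sum E (fun l => l `^ s) n q t z) =
    dotp (stieltjes_sum E (fun l => l `^ u) n q t x)
      (stieltjes_sum E (fun l => l `^ (2 * s - u)) n q t z).
  rewrite !(dotp_stieltjes_sum E_proj E_comp) //; apply: eq_bigr => i _.
  rewrite -!powRD ?t0 ?implybT //.
  by have -> : s + s = u + (2 * s - u) by ring.
apply: le_trans (cauchy_schwarz _ _) _; rewrite ler_wpM2l ?sqr_ge0 //.
rewrite !(normr_stieltjes_sum2 E_proj E_comp) //.
rewrite !mulr_suml -big_split mulr_sumr.
apply: ler_sum => i _.
have := powR_sqr_interpolation (t0 i) P0 Q0.
move=> /(ler_wpM2r (dotpp_ge0 (cell E q i z))) /le_trans; apply.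
by rewrite le_eqVlt; apply/orP; left; apply/eqP => /=; ring.
Qed.

Lemma cvg_dotp_interpolation (T : topologicalType) (F : set_system T)
    {FF : ProperFilter F} (A B C D : T -> X) (ya yb yc yd : X) (c P Q : R) :
  A t @[t --> F] --> ya -> B t @[t --> F] --> yb ->
  C t @[t --> F] --> yc -> D t @[t --> F] --> yd ->
  (\forall t \near F, dotp (A t) (B t) ^+ 2 <=
     `|C t| ^+ 2 * (c * (`|D t| ^+ 2 / P + `|B t| ^+ 2 / Q))) ->
  dotp ya yb ^+ 2 <= `|yc| ^+ 2 * (c * (`|yd| ^+ 2 / P + `|yb| ^+ 2 / Q)).
Proof.
move=> Ay By Cy Dy le_t.
have sqr_cvg (G : T -> X) y : G t @[t --> F] --> y ->
    `|G t| ^+ 2 @[t --> F] --> (`|y| ^+ 2 : R).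
  move=> Gy; have n : `|G t| @[t --> F] --> `|y| by exact: cvg_norm.
  by rewrite expr2; under eq_fun do rewrite expr2; exact: cvgM.
have lhs : dotp (A t) (B t) ^+ 2 @[t --> F] --> dotp ya yb ^+ 2.
  have d : dotp (A t) (B t) @[t --> F] --> dotp ya yb by exact: cvg_dotp.
  by rewrite expr2; under eq_fun do rewrite expr2; exact: cvgM.
apply: (ler_cvg_to lhs _ le_t).
apply: cvgM; first exact: sqr_cvg.
apply: cvgM; first exact: cvg_cst.
by apply: cvgD; (apply: cvgM; [exact: sqr_cvg | exact: cvg_cst]).
Qed.

Lemma spectral_integral_interpolation (P Q : R) x z xs xu zs za :
  0 < P -> 0 < Q ->
  spectral_integral E (fun l => l `^ s) x xs ->
  spectral_integral E (fun l => l `^ u) x xu ->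
  spectral_integral E (fun l => l `^ s) z zs ->
  spectral_integral E (fun l => l `^ (- a)) z za ->
  dotp xs zs ^+ 2 <=
  `|xu| ^+ 2 * (P `^ p * Q `^ (1 - p) * (`|za| ^+ 2 / P + `|zs| ^+ 2 / Q)).
Proof.
move=> P0 Q0 [I hI Ixs] [J hJ Jxu] [K hK Kzs] [M hM Mza].
apply: (cvg_dotp_interpolation Ixs Kzs Jxu Mza).
apply: filterS (nbhs_pinfty_gt (num_real 0)) => b b0.
apply: (cvg_dotp_interpolation (cvg_uniform_sum b0 (hI b b0))
  (cvg_uniform_sum b0 (hK b b0)) (cvg_uniform_sum b0 (hJ b b0))
  (cvg_uniform_sum b0 (hM b b0))).
near=> k; apply: dotp_stieltjes_sum_interpolation => //.
- exact: uniform_node_nondecreasing.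
- by move=> i; exact: uniform_tag_neq0.
Unshelve. all: by end_near. Qed.

End interpolation.

(** * The Hilbert scale *)

Section hilbert_scale.
Context {R : realType} {X : hilbertType R}.
Implicit Types (L : partial_fun X X) (x y z : X) (nu s u a : R).

(** The default value of [spectral_family], the zero family, also consists of
commuting projections with limits at both ends, so that these properties hold
whether or not [L] has a spectral family. *)
Lemma spectral_familyP L : let E := spectral_family L in
  [/\ forall l, orthogonal_projector (E l),
      forall l k x, E l (E k x) = E (Num.min l k) x,
      forall x, cvg (E l x @[l --> -oo])
    & forall x, cvg (E l x @[l --> +oo])].
Proof.
rewrite /spectral_family.
have [ex|nex] := pselect (exists E, spectral_family_of L E).
  have [[h1 h2 _ h3 h4] _] := xgetPex (fun _ _ => 0) ex.
  by split=> // x; apply/cvg_ex; [exists 0; exact: h3 | exists x; exact: h4].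
rewrite xgetPN => [|E hE]; last by apply: nex; exists E.
split=> //.
- split=> [c x y| |x y]; rewrite ?dotp0l ?dotp0r //.
  by rewrite scaler0 addr0.
- by move=> x; apply: is_cvg_cst.
- by move=> x; apply: is_cvg_cst.
Qed.

Lemma op_powerP L nu x : hscale L nu x ->
  spectral_integral (spectral_family L) (fun l => l `^ nu) x (op_power L nu x).
Proof. by move=> hx; exact: (xgetPex 0 hx). Qed.

Lemma hscale_normE L nu x : hscale L nu x ->
  hscale_norm L nu x = `|op_power L nu x|%:E.
Proof. by move=> hx; rewrite /hscale_norm mem_set. Qed.

Lemma hscale_norm_notin L nu x : ~ hscale L nu x -> hscale_norm L nu x = +oo%E.
Proof. by move=> hx; rewrite /hscale_norm memNset. Qed.

Lemma hscale_norm_fin L nu x (r : R) : (hscale_norm L nu x <= r%:E)%E ->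
  hscale L nu x.
Proof.
by move=> le_r; apply: contrapT => hx; move: le_r; rewrite hscale_norm_notin.
Qed.

Lemma hscale_le L s u x : 0 <= s < u -> hscale L u x -> hscale L s x.
Proof.
move=> /andP[s0 su] [y hy]; have [Ep Ec Em EM] := spectral_familyP L.
(* oscillation_dominated fails for s = 0, since l^0 = 1 does not vanish at 0 *)
have [s_eq0|s_neq0] := eqVneq s 0.
  have /cvg_ex[l_ hl_] := Em x; have /cvg_ex[l' hl'] := EM x.
  by rewrite s_eq0; exact: spectral_integral_powR0 hl_ hl'.
apply: (spectral_integral_dominated Ep Ec _ hy).
by apply: oscillation_dominated_powR; rewrite lt_def s_neq0 s0.
Qed.

Lemma hscaleB L nu x y : hscale L nu x -> hscale L nu y ->
  hscale L nu (x - y) /\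
  op_power L nu (x - y) = op_power L nu x - op_power L nu y.
Proof.
move=> hx hy; have [Ep _ _ _] := spectral_familyP L.
have xy := spectral_integralB Ep (op_powerP hx) (op_powerP hy).
have hxy : hscale L nu (x - y) by exists (op_power L nu x - op_power L nu y).
by split=> //; exact: spectral_integral_unique (op_powerP hxy) xy.
Qed.

Lemma hscale_interpolation L s u a (P Q p : R) x z :
  0 < s + a -> s <= u -> u <= 2 * s + a -> 0 < P -> 0 < Q ->
  hscale L s x -> hscale L u x -> hscale L s z -> hscale L (- a) z ->
  p = (u - s) / (s + a) ->
  dotp (op_power L s x) (op_power L s z) ^+ 2 <=
  `|op_power L u x| ^+ 2 * (P `^ p * Q `^ (1 - p) *
    (`|op_power L (- a) z| ^+ 2 / P + `|op_power L s z| ^+ 2 / Q)).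
Proof.
move=> sa su usa P0 Q0 xs xu zs za ->; have [Ep Ec _ _] := spectral_familyP L.
exact: (spectral_integral_interpolation Ep Ec sa su usa P0 Q0
  (op_powerP xs) (op_powerP xu) (op_powerP zs) (op_powerP za)).
Qed.

End hilbert_scale.

(** * The error estimate *)

Section error_estimate.
Context {R : realType}.
Implicit Types (r N p u s a : R).

(** The constant that balances the exponents: its power 1 + p is the coefficient
in the bound on 4 d^2 in young_absorption, with 4^(1-p) coming from the
factor 1/4 in front of e^2. *)
Definition young_constant r N p : R :=
  (8 * N ^+ 2 * (r ^+ 2) `^ p * 4 `^ (1 - p)) `^ (1 + p)^-1.

(** Both sides are compared through their squares: the exponents 1 + p and 1 - p
add up to 2, so powRM_le_addr bounds A^(1+p) (e^2/4)^(1-p) by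
(A + e^2/4)^2. *)
Lemma young_absorption r N p (v e d : R) : 0 < p <= 1 -> 0 <= v -> 
  d ^+ 2 <= N ^+ 2 * (((r * v) ^+ 2) `^ p * (e ^+ 2) `^ (1 - p) * 2) ->
  2 * `|d| <= e ^+ 2 / 4 + young_constant r N p * v `^ (2 * p / (1 + p)).
Proof.
move=> /andP[p0 p1] v0 d2.
have p1' : 0 <= 1 - p by rewrite subr_ge0.
have p2 : 0 < 1 + p by rewrite addr_gt0.
pose M := 8 * N ^+ 2 * (r ^+ 2) `^ p * 4 `^ (1 - p).
have M0 : 0 <= M by rewrite /M 2?mulr_ge0 ?powR_ge0 // mulr_ge0 // sqr_ge0.
set A := young_constant _ _ _ * _; pose B := e ^+ 2 / 4.
have A0 : 0 <= A by rewrite mulr_ge0 ?powR_ge0.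
have B0 : 0 <= B by rewrite divr_ge0 ?sqr_ge0.
have Ap : A `^ (1 + p) = M * (v ^+ 2) `^ p.
  rewrite /A /young_constant powRM ?powR_ge0 // -!powRrM.
  rewrite mulVf ?gt_eqF // powRr1 //.
  by rewrite divfK ?gt_eqF // -(powR_mulrn 2 v0) -powRrM.
have eB : (e ^+ 2) `^ (1 - p) = 4 `^ (1 - p) * B `^ (1 - p).
  by rewrite -powRM // /B mulrC divfK.
have AB : (2 * `|d|) ^+ 2 <= (A + B) ^+ 2.
  have -> : (A + B) ^+ 2 = (A + B) `^ ((1 + p) + (1 - p)).
    have -> : (1 + p) + (1 - p) = 2%:R by ring.
    by rewrite powR_mulrn // addr_ge0.
  apply: le_trans (powRM_le_addr A0 B0 (ltW p2) p1' _); last by lra.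
  rewrite Ap exprMn real_normK ?num_real //.
  move: d2; rewrite exprMn powRM ?sqr_ge0 // eB /M.
  move: (N ^+ 2) ((r ^+ 2) `^ p) ((v ^+ 2) `^ p) (4 `^ (1 - p)) (B `^ (1 - p)).
  move=> ? ? ? ? ?.
  by lra.
rewrite [leRHS]addrC -ler_sqr ?nnegrE ?addr_ge0 // mulr_ge0 //.
Qed.

(** The weights 3 and 3/2 come from 2 t d <= 2 t^2 + d^2 / 2. *)
Lemma sqr_triangle_le (t d D : R) : 0 <= D -> D <= t + d ->
  D ^+ 2 <= 3 * t ^+ 2 + 3 / 2 * d ^+ 2.
Proof.
move=> D0 Dtd; apply: (@le_trans _ _ ((t + d) ^+ 2)).
  by rewrite lerXn2r ?nnegrE // (le_trans D0).
have := sqr_ge0 (2 * t - d); lra.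
Qed.

(** After absorption the factor of e^2 is 3/4, and (d^2 - t^2)/2 is at most
3/4 d^2 - D^2/6. Multiplying by 4/3 leaves d^2 - 2/9 D^2, and 1/8 < 2/9. *)
Lemma absorbed_error_le (al t d D e y z i C K V : R) :
  0 < al -> 0 <= D -> D <= t + d -> 0 <= V -> 4 / 3 * K <= C ->
  2^-1 * t ^+ 2 + al * z <= 2^-1 * d ^+ 2 + al * y ->
  z = y + 2 * i + e ^+ 2 ->
  2 * `|i| <= e ^+ 2 / 4 + K * V ->
  e ^+ 2 <= d ^+ 2 / al + (C * V - D ^+ 2 / (8 * al)).
Proof.
move=> al0 D0 Dtd V0 KC + zE young; rewrite {}zE => tik.
have tri := sqr_triangle_le D0 Dtd.
have iN : - i <= `|i| by rewrite -normrN ler_norm.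
have K1 : al * (4 / 3 * K * V) <= al * (C * V).
  by rewrite ler_pM2l // ler_wpM2r.
have K2 : al * (- (2 * i)) <= al * (e ^+ 2 / 4 + K * V).
  by rewrite ler_pM2l //; lra.
rewrite -(ler_pM2l al0).
have -> : al * (d ^+ 2 / al + (C * V - D ^+ 2 / (8 * al))) =
    d ^+ 2 + al * (C * V) - D ^+ 2 / 8.
  by field; rewrite gt_eqF.
have := sqr_ge0 d; have := sqr_ge0 D; lra.
Qed.

Lemma fenchel_psi_ge (phi : R -> R) u s a (v t : R) : 0 <= t ->
  ((psi_usa phi u s a t - v * t)%R%:E <=
   fenchel (extend_pos (fun t => - psi_usa phi u s a t)%R) (- v)%R)%E.
Proof.
move=> t0; apply: ereal_sup_ubound; exists t => //.
by rewrite /extend_pos t0 -EFinB opprK mulrN addrC mulrC.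
Qed.

End error_estimate.

Section tikhonov_minimizers.
Context {R : realType} {X Y : hilbertType R}.

(** A minimizer has a finite penalty because fd is a competitor with finite
penalty. *)
Lemma argmin_in_hscale (L : partial_fun X X) (F : partial_fun X Y) (s al : R)
    (gd : Y) (fd f : X) :
  0 < al -> dom F fd -> hscale L s fd ->
  argmin (dom F) (tikhonov L F s al gd) f -> hscale L s f /\
  2^-1 * `|F f - gd| ^+ 2 + al * `|op_power L s f| ^+ 2 <=
  2^-1 * `|F fd - gd| ^+ 2 + al * `|op_power L s fd| ^+ 2.
Proof.
move=> al0 Ffd sfd [_ /(_ fd Ffd)]; rewrite /tikhonov (hscale_normE sfd).
have [sf|nsf] := pselect (hscale L s f).
  by rewrite (hscale_normE sf) => le_T; split=> //; rewrite -lee_fin.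
rewrite (hscale_norm_notin nsf) expe2 mulyy gt0_muley ?lte_fin // addey //.
Qed.

End tikhonov_minimizers.

Theorem theorem1 (R : realType) (Rc N u s a : R) :
  exists C : R, 0 < C /\
  forall (X Y : hilbertType R)
    (L : partial_fun X X) (F : partial_fun X Y) (fd : X) (g : Y)
    (phi : R -> R) (theta rho : R) (Q : set X)
    (gd : R -> Y) (alpha : R -> Y -> R) (fr : R -> X) (dbar : R),
  separable X -> infinite_dimensional X ->
  separable Y -> infinite_dimensional Y ->
  hilbert_scale_generator L ->
  locally_ill_posed F fd ->
  basic_assumption L F g fd u s a ->
  hscale_norm L u fd = N%:E ->
  conditional_stability L F fd a phi theta rho Rc Q ->
  (forall d, 0 < d -> `|gd d - g| <= d) ->
  (forall d, 0 < d -> 0 < alpha d (gd d)) ->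
  (forall d, 0 < d ->
     argmin (dom F) (tikhonov L F s (alpha d (gd d)) (gd d)) (fr d)) ->
  0 < dbar ->
  (forall d, 0 < d <= dbar -> Q (fr d)) ->
  forall d, 0 < d <= dbar ->
  (hscale_norm L s (fr d - fd)%R ^+ 2 <=
     (d ^+ 2 / alpha d (gd d))%R%:E
     + C%:E * fenchel (extend_pos (fun t => - psi_usa phi u s a t)%R)
                (- (1 / (8 * C * alpha d (gd d))))%R)%E.
Proof.
pose p := (u - s) / (s + a); pose K := young_constant Rc N p.
have K0 : 0 <= K by exact: powR_ge0.
exists (4 / 3 * K + 1); split; first lra.
set C := 4 / 3 * K + 1; have C0 : 0 < C by rewrite /C; lra.
move=> X Y L F fd g phi theta rho Q gd alpha fr dbar _ _ _ _ _ _.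
move=> [_ _ [u0 ufd [Ffd Fg Funi]] [a0 s0 su usa _]] normN.
move=> [[[_ phi_incr phi0] _] [_ _ Rc0] _ stab] noise al_gt0 argm _ inQ d dd.
have d0 : 0 < d by case/andP: dd.
have := al_gt0 d d0; have := argm d d0; have := noise d d0; have := inQ d dd.
move: (fr d) (gd d) (alpha d (gd d)).
move=> {al_gt0 argm noise inQ alpha gd fr dd} f gd al.
move=> Qf noise argm al0.
have sfd : hscale L s fd by apply: hscale_le ufd; rewrite s0 su.
have [sf tik] := argmin_in_hscale al0 Ffd sfd argm.
have [sh hE] := hscaleB sf sfd.
have ah := hscale_norm_fin (stab f Qf).
have wD := stab f Qf; rewrite (hscale_normE ah) lee_fin in wD.
have NE : `|op_power L u fd| = N.
  by move: normN; rewrite (hscale_normE ufd) => -[].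
rewrite (hscale_normE sh) -EFin_expe.
set e := `|op_power L s (f - fd)|; set D := `|F f - F fd| in wD.
set fen := fenchel _ _.
have fen_ge t : 0 <= t ->
    ((psi_usa phi u s a t - 1 / (8 * C * al) * t)%R%:E <= fen)%E.
  exact: fenchel_psi_ge.
have psiE t : 0 <= t -> psi_usa phi u s a (t ^+ 2) = phi t `^ (2 * p / (1 + p)).
  move=> t0; rewrite /psi_usa sqrtr_sqr ger0_norm //; congr (_ `^ _).
  rewrite /p; field; rewrite !gt_eqF //=; lra.
have as0 : 0 < s + a by lra.
have p01 : 0 < p <= 1.
  by rewrite /p divr_gt0 ?subr_gt0 //= ler_pdivrMr // mul1r; lra.
have [e_eq0|e_neq0] := eqVneq e 0.
  (* the competitor t = 0 shows that the conjugate is nonnegative *)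
  rewrite e_eq0 expr0n /= adde_ge0 ?lee_fin ?divr_ge0 ?sqr_ge0 ?(ltW al0) //.
  rewrite mule_ge0 ?lee_fin ?(ltW C0) //.
  apply: le_trans (fen_ge (0 ^+ 2) (sqr_ge0 0)).
  rewrite psiE // phi0 expr0n mulr0 subr0 lee_fin powR_ge0 //.
have D0 : 0 < D.
  rewrite lt_def normr_ge0 andbT normr_eq0 subr_eq0; apply/eqP => FE.
  move: e_neq0; rewrite /e hE (Funi f) ?subrr ?normr0 ?eqxx //.
    by case: argm.
  by rewrite FE.
have v0 : 0 < phi D.
  by rewrite -phi0; apply: phi_incr => //; rewrite in_itv /= andbT // ltW.
have e0 : 0 < e by rewrite lt_def e_neq0 normr_ge0.
set i := dotp (op_power L s fd) (op_power L s (f - fd)).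
(* With P and Q the squares of the bounds on |h|_(-a) and |h|_s, both ratios
   in the interpolation inequality are at most 1. *)
have i2 : i ^+ 2 <=
    N ^+ 2 * (((Rc * phi D) ^+ 2) `^ p * (e ^+ 2) `^ (1 - p) * 2).
  have P0 : 0 < (Rc * phi D) ^+ 2 by rewrite exprn_gt0 // mulr_gt0.
  have Q0 : 0 < e ^+ 2 by rewrite exprn_gt0.
  apply: le_trans (hscale_interpolation as0 (ltW su) usa P0 Q0 sfd ufd sh ah
    (erefl p)) _.
  rewrite NE ler_wpM2l ?sqr_ge0 // ler_wpM2l ?mulr_ge0 ?powR_ge0 //.
  rewrite -/e divff ?gt_eqF // lerD2r ler_pdivrMr // mul1r.
  rewrite lerXn2r ?nnegrE ?normr_ge0 // mulr_ge0 ?ltW //.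
have young := young_absorption p01 (ltW v0) i2.
have Dtd : D <= `|F f - gd| + d.
  rewrite /D -[F f](subrK gd) -addrA; apply: le_trans (ler_normD _ _) _.
  by rewrite addrK lerD2l Fg.
have tik' : 2^-1 * `|F f - gd| ^+ 2 + al * `|op_power L s f| ^+ 2 <=
    2^-1 * d ^+ 2 + al * `|op_power L s fd| ^+ 2.
  apply: le_trans tik _.
  rewrite lerD2r ler_pM2l // lerXn2r ?nnegrE ?(ltW d0) //.
  by rewrite Fg distrC.
have polar : `|op_power L s f| ^+ 2 = `|op_power L s fd| ^+ 2 + 2 * i + e ^+ 2.
  by rewrite /i /e -sqr_normD hE addrC subrK.
have KC : 4 / 3 * K <= C by rewrite /C; lra.
have err :=
  absorbed_error_le al0 (ltW D0) Dtd (powR_ge0 _ _) KC tik' polar young.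
(* the competitor t = D^2 in the conjugate *)
apply: (@le_trans _ _ ((d ^+ 2 / al)%:E +
    C%:E * (psi_usa phi u s a (D ^+ 2) - 1 / (8 * C * al) * D ^+ 2)%:E)%E).
  rewrite -EFinM -EFinD lee_fin psiE ?(ltW D0) //.
  have -> : C * (phi D `^ (2 * p / (1 + p)) - 1 / (8 * C * al) * D ^+ 2) =
      C * phi D `^ (2 * p / (1 + p)) - D ^+ 2 / (8 * al).
    by field; rewrite !gt_eqF.
  exact: err.
by rewrite leeD2l // lee_wpmul2l ?lee_fin ?(ltW C0) // fen_ge ?sqr_ge0.
Qed.
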